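(* Let $A:D(A)\subset X\to X$ be a self-adjoint, positive operator with compact resolvent, with eigenvalues $(\mu_n)_{n\in\mathbb N^*}$, and let $K:D(A)\to X$ be a self-adjoint, non-negative, compact operator. Let $(\tilde\mu_n)_{n\in\mathbb N^*}$ be the eigenvalues of $A_K=A+K$, in increasing order. Then there exists a continuous function $f:\mathbb R_+\to\mathbb R$ with $\lim_{\mu\to+\infty}f(\mu)=0$ such that $$\tilde\mu_n=\mu_n\bigl(1+f(\mu_n)\bigr)\qquad\text{for all } n\in\mathbb N^*.$$
   Context: $X$ is an infinite-dimensional (complex) Hilbert space with inner product $\langle\cdot,\cdot\rangle_X$. $A$ is linear, unbounded, densely defined, self-adjoint, with compact resolvent. Its spectrum is $\{\mu_k\}_{k\in\mathbb N^*}$ with $0<\mu_1<\mu_2<\cdots$, and $(\phi_k)_{k\in\mathbb N^*}$ is an orthonormal basis of $X$ with $A\phi_k=\mu_k\phi_k$ (one eigenfunction for each $\mu_k$, i.e. the eigenvalues are simple). The domain $D(A)$ carries the norm $\|z\|_{D(A)}=\|Az\|_X$. The operator $K:D(A)\to X$ is compact from $D(A)$ (with this norm) to $X$; ''self-adjoint, non-negative'' means $\langle Ku,v\rangle_X=\langle u,Kv\rangle_X$ and $\langle Ku,u\rangle_X\ge 0$ for all $u,v\in D(A)$. The operator $A_K=A+K$, with domain $D(A)$, is self-adjoint with compact resolvent; its eigenvalues $\tilde\mu_n$ are listed in increasing order, counted with multiplicity. *)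

(* Defs.v *)
From HB Require Import structures.
From mathcomp Require Export all_boot all_order all_algebra sesquilinear complex.
From mathcomp Require Export all_classical all_reals all_analysis.
Set Implicit Arguments.
Unset Strict Implicit.
Unset Printing Implicit Defensive.
Export Order.TTheory GRing.Theory Num.Theory.
Export numFieldNormedType.Exports.
#[global] Open Scope classical_set_scope.
#[global] Open Scope ring_scope.
#[global] Open Scope complex_scope.

(* An operator with domain D is a pair (D, T) with D : set X and T : X -> X;
   only the values of T on D are ever used. Inner products are linear in the
   first argument and conjugate-linear in the second. *)

Definition is_inner_product (R : realType) (X : normedModType R[i])
    (ip : {dot X for Num.conj}) : Prop :=
  forall x, ip x x = `|x| ^+ 2.

Definition linear_operator (R : realType) (X : normedModType R[i])
    (D : set X) (T : X -> X) : Prop :=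
  D 0 /\
  forall (a : R[i]) (u v : X), D u -> D v ->
    D (a *: u + v) /\ T (a *: u + v) = a *: T u + T v.

Definition unbounded (R : realType) (X : normedModType R[i])
    (D : set X) (T : X -> X) : Prop :=
  ~ exists C : R, forall u, D u -> `|T u| <= C%:C * `|u|.

(* The graph of T and the graph of its adjoint coincide. *)
Definition self_adjoint (R : realType) (X : normedModType R[i])
    (ip : {dot X for Num.conj}) (D : set X) (T : X -> X) : Prop :=
  dense D /\
  forall v w : X,
    (forall u, D u -> ip (T u) v = ip u w) <-> (D v /\ w = T v).

Definition symmetric_on (R : realType) (X : normedModType R[i])
    (ip : {dot X for Num.conj}) (D : set X) (T : X -> X) : Prop :=
  forall u v, D u -> D v -> ip (T u) v = ip u (T v).

(* In R[i], 0 <= z and 0 < z entail that z is real. *)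
Definition nonnegative_on (R : realType) (X : normedModType R[i])
    (ip : {dot X for Num.conj}) (D : set X) (T : X -> X) : Prop :=
  forall u, D u -> 0 <= ip (T u) u.

Definition positive_on (R : realType) (X : normedModType R[i])
    (ip : {dot X for Num.conj}) (D : set X) (T : X -> X) : Prop :=
  forall u, D u -> u != 0 -> 0 < ip (T u) u.

(* Compactness of T from D, normed by N, to X. *)
Definition compact_operator (R : realType) (X : normedModType R[i])
    (D : set X) (N : X -> R[i]) (T : X -> X) : Prop :=
  precompact (T @` [set u | D u /\ N u <= 1]).

(* S is the bounded inverse of T - l : D -> X. *)
Definition is_resolvent (R : realType) (X : normedModType R[i])
    (D : set X) (T : X -> X) (l : R[i]) (S : X -> X) : Prop :=
  [/\ continuous S,
      forall x, D (S x) /\ T (S x) - l *: S x = x &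
      forall u, D u -> S (T u - l *: u) = u].

Definition spectrum (R : realType) (X : normedModType R[i])
    (D : set X) (T : X -> X) : set R[i] :=
  [set l | ~ exists S, is_resolvent D T l S].

Definition compact_resolvent (R : realType) (X : normedModType R[i])
    (D : set X) (T : X -> X) : Prop :=
  exists l S, is_resolvent D T l S /\
    compact_operator setT (fun x : X => `|x|) S.

Definition orthonormal_basis (R : realType) (X : normedModType R[i])
    (ip : {dot X for Num.conj}) (phi : nat -> X) : Prop :=
  (forall i j, ip (phi i) (phi j) = (i == j)%:R) /\
  (forall x, series (fun k => ip x (phi k) *: phi k) @ \oo --> x).

Definition has_dim (R : realType) (X : normedModType R[i])
    (E : set X) (d : nat) : Prop :=
  exists b : 'I_d -> X,
    (forall c : 'I_d -> R[i], \sum_i c i *: b i = 0 -> forall i, c i = 0) /\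
    E = range (fun c : 'I_d -> R[i] => \sum_i c i *: b i).

Definition infinite_dimensional (R : realType) (X : normedModType R[i]) :
    Prop :=
  forall d, ~ has_dim [set: X] d.

Definition eigenspace (R : realType) (X : normedModType R[i])
    (D : set X) (T : X -> X) (l : R[i]) : set X :=
  [set u | D u /\ T u = l *: u].

(* The number of occurrences of l in m is the dimension of ker (T - l), for
   every complex l: it is 0 iff l is not an eigenvalue, and infinite iff the
   kernel is infinite-dimensional. *)
Definition eigenvalues_with_multiplicity (R : realType)
    (X : normedModType R[i]) (D : set X) (T : X -> X) (m : nat -> R) : Prop :=
  nondecreasing_seq m /\
  forall (l : R[i]) (d : nat),
    has_dim (eigenspace D T l) d <-> ([set n | (m n)%:C = l] #= `I_d)%card.

(* Main.v *)
(* Compactness of K relative to A gives |K u| <= eps |A u| + C |u| on D(A). On the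
   span of phi_0, ..., phi_n this bounds the form of A + K by
   c = mu_n (1 + eps) + C, while the form is at least mu_n on the orthogonal of
   phi_0, ..., phi_(n-1), since K >= 0. The second fact yields mu_n <= mut_n by
   dimension counting. For mut_n <= c one needs n + 1 orthonormal eigenvectors of
   A + K with eigenvalues at most c: they are limits of Galerkin (Ritz) vectors on
   the span of the first N vectors phi_k, whose A-norms stay bounded, so that both
   they and their images by K converge along an ultrafilter. Hence
   mut_n / mu_n - 1 tends to 0, and f interpolates these values piecewise
   linearly. *)
Require Import Defs.
From mathcomp Require Import lra ring spectral.
Set Implicit Arguments.
Unset Strict Implicit.
Unset Printing Implicit Defensive.

(** * Finite-dimensional linear algebra: eigenvectors of Hermitian matrices *)

Lemma rV_kernel_neq0 (F : fieldType) (p q : nat) (M : 'M[F]_(q, p)) :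
  (p < q)%N -> exists2 a : 'rV_q, a != 0 & a *m M = 0.
Proof.
move=> pq; have /rowV0Pn[a /sub_kermxP aM a0] : kermx M != 0.
  by rewrite -mxrank_eq0 mxrank_ker -lt0n subn_gt0 (leq_ltn_trans (rank_leq_col M)).
by exists a.
Qed.

Lemma mulmx_trC_row (C : numClosedFieldType) N (x y : 'rV[C]_N) :
  (x *m (y ^t* )%sesqui) 0 0 = \sum_i x 0 i * (y 0 i)^*.
Proof. by rewrite mxE; apply: eq_bigr => i _; rewrite !mxE. Qed.

(* If at most n eigenvalues were <= c, some nonzero vector supported in the first
   n + 1 coordinates would be orthogonal to their eigenvectors, and the form would
   exceed c on it. *)
Lemma ritz_vectors (C : numClosedFieldType) (n N : nat) (H : 'M[C]_N) (c : C) :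
  (n < N)%N -> H \is hermsymmx -> c \is Num.real ->
  (forall x : 'rV_N, (forall j : 'I_N, (n < j)%N -> x 0 j = 0) ->
    (x *m H *m (x ^t* )%sesqui) 0 0 <= c * (x *m (x ^t* )%sesqui) 0 0) ->
  exists (V : 'M[C]_(n.+1, N)) (l : 'rV[C]_n.+1),
    [/\ V \is unitarymx, V *m H = diag_mx l *m V & forall i, l 0 i <= c].
Proof.
move=> nN Hh cr Hc.
set P := spectralmx H; set sp := spectral_diag H.
have HE : H = invmx P *m diag_mx sp *m P.
  exact/orthomx_spectralP/hermitian_normalmx.
have Pu : P \is unitarymx := spectral_unitarymx H.
have PtP : (P ^t* )%sesqui *m P = 1%:M.
  by rewrite -invmx_unitary // mulVmx ?unitarymx_unit.
have spr i : sp 0 i \is Num.real.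
  by have /mxOverP := hermitian_spectral_diag_real Hh; apply.
(* The rows of [P] are orthonormal left eigenvectors of [H]; n + 1 of those indexed by [I] will
   serve once [I] is large enough. *)
pose I := [pred i | sp 0 i <= c].
suff nI : (n < #|I|)%N.
  pose h (i : 'I_n.+1) : 'I_N := enum_val (widen_ord nI i).
  have hI i : h i \in I by exact: enum_valP.
  have hinj : injective h.
    by move=> i j /enum_val_inj /(congr1 val) /= /val_inj.
  exists (rowsub h P), (\row_i sp 0 (h i)); split.
  - apply/unitarymxP/matrixP => i j.
    have /matrixP/(_ (h i) (h j)) := unitarymxP Pu.
    rewrite !mxE (inj_eq hinj) => <-; apply: eq_bigr => k _.
    by rewrite !mxE.
  - apply/matrixP => i j; rewrite mul_diag_mx mxE [in RHS]mxE.
    have : P *m H = diag_mx sp *m P.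
      by rewrite HE !mulmxA mulmxV ?unitarymx_unit // mul1mx.
    move=> /matrixP/(_ (h i) j); rewrite mul_diag_mx mxE [in RHS]mxE => HH.
    by rewrite !mxE in HH *; rewrite -HH; apply: eq_bigr => k _; rewrite !mxE.
  - by move=> i; rewrite mxE; exact: hI.
rewrite ltnNge; apply/negP => In.
(* [Q] pads a row of length n + 1 with zeros; [a] is chosen so that [a *m Q] has no component along
   the eigenvectors in [I]. *)
pose Q : 'M[C]_(n.+1, N) := pid_mx n.+1.
have [a a0 aM] := @rV_kernel_neq0 C #|I| n.+1
  (colsub (@enum_val _ I) (Q *m (P ^t* )%sesqui)) In.
pose x := a *m Q; pose y := x *m (P ^t* )%sesqui.
have yI i : i \in I -> y 0 i = 0.
  move=> iI; move/matrixP: aM => /(_ 0 (enum_rank_in iI i)).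
  rewrite [RHS]mxE mxE => E; rewrite /y /x -mulmxA mxE -[RHS]E.
  by apply: eq_bigr => k _; rewrite [in RHS]mxE enum_rankK_in.
have xE : x = y *m P by rewrite /y -mulmxA PtP mulmx1.
have yHy : (x *m H *m (x ^t* )%sesqui) 0 0 = \sum_i sp 0 i * `|y 0 i| ^+ 2.
  have -> : x *m H *m (x ^t* )%sesqui = y *m diag_mx sp *m (y ^t* )%sesqui.
    rewrite HE /y !(trmx_mul, map_mxM) /= trmxCK invmx_unitary // !mulmxA.
    by [].
  rewrite mulmx_trC_row; apply: eq_bigr => i _.
  by rewrite mul_mx_diag mxE normCK; ring.
have yy : (x *m (x ^t* )%sesqui) 0 0 = \sum_i `|y 0 i| ^+ 2.
  rewrite xE trmx_mul map_mxM /= mulmxA mulmxtVK //.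
  by rewrite mulmx_trC_row; apply: eq_bigr => i _; rewrite normCK.
have x0 (j : 'I_N) : (n < j)%N -> x 0 j = 0.
  move=> nj; rewrite mxE big1 // => k _; rewrite mxE.
  by case: eqP => [kj|]; rewrite ?mulr0 // kj ltnNge nj mulr0.
(* The sum of (sp i - c) |y i|^2 is at most 0 although each term is nonnegative; outside [I] the
   factor is nonzero, so [y] vanishes. *)
have := Hc x x0; rewrite yHy yy mulr_sumr -subr_ge0 -sumrB => sle.
have t0 i : 0 <= sp 0 i * `|y 0 i| ^+ 2 - c * `|y 0 i| ^+ 2.
  rewrite -mulrBl; have [iI|iI] := boolP (i \in I).
    by rewrite yI // normr0 expr0n mulr0.
  rewrite mulr_ge0 ?exprn_ge0 // subr_ge0 ltW //.
  by rewrite real_ltNge.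
have y0 : y = 0.
  apply/rowP => i; rewrite [RHS]mxE.
  have [iI|iI] := boolP (i \in I); first exact: yI.
  have /eqP : \sum_i (sp 0 i * `|y 0 i| ^+ 2 - c * `|y 0 i| ^+ 2) = 0.
    apply/eqP; rewrite eq_le sumr_ge0 // andbT -oppr_ge0 -sumrN.
    by rewrite (eq_bigr _ (fun i _ => opprB _ _)).
  rewrite psumr_eq0 // => /allP/(_ i (mem_index_enum _)) /=.
  rewrite -mulrBl mulf_eq0 subr_eq0 => /orP[/eqP spc|].
    by move: iI; rewrite inE spc lexx.
  by rewrite expf_eq0 /= normr_eq0 => /eqP.
move: a0; suff -> : a = 0 by rewrite eqxx.
have : a *m Q *m (pid_mx n.+1 : 'M[C]_(N, n.+1)) = a.
  rewrite -mulmxA mul_pid_mx minnn (minn_idPr nN) pid_mx_1 mulmx1 //.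
by rewrite -/x xE y0 !mul0mx => ->.
Qed.

(** * Limits in [R[i]] and along ultrafilters *)

Lemma conj_real_complex (R : realType) (a : R) : Num.conj (a%:C) = a%:C.
Proof. by rewrite conj_Creal // complex_real. Qed.

(* R[i] carries its topology only through the alias R[i]^o. *)
Section Limits.
Variables (R : realType) (T : Type) (F : set_system T).
Context {FF : ProperFilter F}.

Lemma cvg_real_complex (f : T -> R) (l : R) :
  f t @[t --> F] --> l -> ((f t)%:C : R[i]^o) @[t --> F] --> (l%:C : R[i]^o).
Proof.
move=> fl; apply/cvgrPdist_lt => e e0.
move: e0; rewrite ltcE /= => /andP[/eqP ei e0].
near=> t; rewrite -rmorphB /= normc_def /= expr0n addr0 sqrtr_sqr ltcE /= ei eqxx /=.
near: t; move: fl => /cvgrPdist_lt; exact.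
Unshelve. all: by end_near. Qed.

(** A nonnegative element equals its norm, and this equality passes to the limit; in particular the
    limit is real. *)
Lemma cvg_complex_ge0 (f : T -> R[i]^o) (l : R[i]^o) :
  f t @[t --> F] --> l -> (\forall t \near F, 0 <= (f t : R[i])) -> 0 <= (l : R[i]).
Proof.
move=> fl f0; suff -> : l = `|l| by exact: normr_ge0.
apply: (@norm_cvg_unique _ R[i]^o (f @ F) _ l `|l| fl).
apply: cvg_trans (cvg_norm fl).
apply: near_eq_cvg; near=> t; rewrite ger0_norm //; near: t; exact: f0.
Unshelve. all: by end_near. Qed.

End Limits.

Lemma fmap_ultra (S T : Type) (f : S -> T) (U : set_system S) :
  UltraFilter U -> UltraFilter (f @ U).
Proof.
move=> UU; split=> [|G GF fUG]; first exact: fmap_proper_filter.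
rewrite eqEsubset; split=> // A GA.
have [//|UnA] := in_ultra_setVsetC (f @^-1` A) UU.
have GnA : G (~` A) by exact: fUG.
by have [x []] := filter_ex (filterI GA GnA).
Qed.

(** Ultrafilters stand in for the extraction of subsequences: a single one serves for several
    sequences at once. *)
Lemma precompact_ultra_cvg (V : topologicalType) (P : set V) (S : Type)
    (U : set_system S) (f : S -> V) :
  UltraFilter U -> precompact P -> (\forall s \near U, P (f s)) ->
  exists x : V, f s @[s --> U] --> x.
Proof.
move=> UU; rewrite precompactE compact_ultra => cP Pf.
have [|x [_ fx]] := cP _ (fmap_ultra f UU); last by exists x.
by apply: filterS Pf => s; exact: subset_closure.
Qed.

(** * Inner products: Cauchy-Schwarz, continuity, orthonormal families *)

Section InnerProduct.
Variables (R : realType) (X : normedModType R[i]) (ip : {dot X for Num.conj}).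
Hypothesis ip_norm : is_inner_product ip.

Lemma ipC x y : ip x y = (ip y x)^*.
Proof. by rewrite hermC /= expr0 mul1r. Qed.

Lemma ipZr a x y : ip x (a *: y) = a^* * ip x y.
Proof. by rewrite linearZr_LR. Qed.

Lemma ipDl x y z : ip (x + y) z = ip x z + ip y z.
Proof. exact: linearDl. Qed.

Lemma ipDr x y z : ip x (y + z) = ip x y + ip x z.
Proof. exact: linearDr. Qed.

Lemma ipBl x y z : ip (x - y) z = ip x z - ip y z.
Proof. exact: linearBl. Qed.

Lemma ip_cauchy_schwarz x y : `|ip x y| <= `|x| * `|y|.
Proof.
have [->|y0] := eqVneq y 0; first by rewrite linear0r !normr0 mulr0.
have y2 : 0 < `|y| ^+ 2 by rewrite exprn_gt0 // normr_gt0.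
rewrite -(@ler_pXn2r _ 2) ?nnegrE ?mulr_ge0 // exprMn -ler_pdivrMr //.
(* [x - a *: y] is the component of [x] orthogonal to [y], of square norm |x|^2 - |<x, y>|^2 /
   |y|^2. *)
pose a := ip x y / `|y| ^+ 2.
have : 0 <= ip (x - a *: y) (x - a *: y) by exact: dnorm_ge0.
rewrite dnormB dnormZ ipZr !ip_norm.
have -> : a^* * ip x y = `|ip x y| ^+ 2 / `|y| ^+ 2.
  rewrite /a rmorphM /= fmorphV rmorphXn /=. rewrite (conj_Creal (normr_real y)) normCK.
  by rewrite mulrAC [X in X / _]mulrC.
rewrite rmorphM rmorphXn fmorphV rmorphXn /= conj_normC (conj_Creal (normr_real y)).
have -> : `|a| ^+ 2 * `|y| ^+ 2 = `|ip x y| ^+ 2 / `|y| ^+ 2.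
  by rewrite normf_div normrX normr_id; field; rewrite normr_eq0.
by rewrite opprD addrA addrK subr_ge0.
Qed.

Section Limits.
Variables (T : Type) (F : set_system T).
Context {FF : ProperFilter F}.

Lemma ip_cvg (f g : T -> X) (x y : X) :
  f t @[t --> F] --> x -> g t @[t --> F] --> y ->
  (ip (f t) (g t) : R[i]^o) @[t --> F] --> (ip x y : R[i]^o).
Proof.
move=> fx gy.
pose h t := `|f t - x| * `|g t| + `|x| * `|g t - y|.
have h0 : (h t : R[i]^o) @[t --> F] --> (0 : R[i]^o).
  have -> : 0 = `|x - x| * `|y| + `|x| * `|y - y| :> R[i]^o.
    by rewrite !subrr !normr0 mul0r mulr0 addr0.
  apply: cvgD; apply: cvgM; [| exact: cvg_norm | exact: cvg_cst | ];
    apply: cvg_norm; apply: cvgB => //; exact: cvg_cst.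
apply/cvgrPdist_lt => e e0.
move: h0 => /cvgr0Pnorm_lt/(_ e e0) hh.
near=> t; have ht : `|h t| < e by near: t.
apply: le_lt_trans ht.
have -> : ip x y - ip (f t) (g t) = - (ip (f t - x) (g t) + ip x (g t - y)).
  by rewrite linearBl linearBr; ring.
have -> : `|h t| = h t by rewrite ger0_norm // addr_ge0 ?mulr_ge0.
by rewrite normrN (le_trans (ler_normD _ _)) // lerD // ip_cauchy_schwarz.
Unshelve. all: by end_near. Qed.

(** This is how the Galerkin equations and the symmetry of [K], tested against fixed vectors, are
    carried over to limits. *)
Lemma ip_cvg_eq (f f' : T -> X) (x x' y y' : X) :
  f t @[t --> F] --> x -> f' t @[t --> F] --> x' ->
  (\forall t \near F, ip (f t) y = ip (f' t) y') -> ip x y = ip x' y'.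
Proof.
move=> fx fx' E.
apply: (@norm_cvg_unique _ R[i]^o ((fun t => ip (f t) y) @ F)).
  exact: ip_cvg fx (cvg_cst y).
apply: cvg_trans (ip_cvg fx' (cvg_cst y')).
by apply: near_eq_cvg; near=> t; apply/esym; near: t.
Unshelve. all: by end_near. Qed.

End Limits.

Section Orthonormal.
Variables (n : nat) (e : 'I_n -> X).
Hypothesis e_on : forall i j, ip (e i) (e j) = (i == j)%:R.

Lemma ip_suml_orthonormal (a : 'I_n -> R[i]) j : ip (\sum_i a i *: e i) (e j) = a j.
Proof.
rewrite linear_sumlz (bigD1 j) //= linearZl_LR /= e_on eqxx mulr1 big1 ?addr0 // => i ij.
by rewrite linearZl_LR /= e_on (negPf ij) mulr0.
Qed.

Lemma ip_sum_orthonormal (a b : 'I_n -> R[i]) :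
  ip (\sum_i a i *: e i) (\sum_i b i *: e i) = \sum_i a i * (b i)^*.
Proof.
rewrite linear_sumr; apply: eq_bigr => i _.
by rewrite linearZr_LR /= ip_suml_orthonormal mulrC.
Qed.

Lemma normr_sum_orthonormal (a : 'I_n -> R[i]) :
  `|\sum_i a i *: e i| ^+ 2 = \sum_i `|a i| ^+ 2.
Proof.
by rewrite -ip_norm ip_sum_orthonormal; apply: eq_bigr => i _; rewrite normCK.
Qed.

End Orthonormal.

End InnerProduct.

(** * Counting indices *)

Lemma card_mem_uniq (s : seq nat) : uniq s -> ([set k | k \in s] #= `I_(size s))%card.
Proof.
move=> us; have -> : [set k | k \in s] = nth 0%N s @` `I_(size s).
  rewrite eqEsubset; split=> k /=.
    by move=> ks; exists (index k s); rewrite /= ?index_mem ?nth_index.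
  by move=> [i ilt <-]; exact: mem_nth.
apply: inj_card_eq => i j /set_mem /= il /set_mem /= jl /eqP.
by rewrite nth_uniq // => /eqP.
Qed.

Lemma size_uniq_le_card (s : seq nat) (S : set nat) d :
  uniq s -> (forall k, k \in s -> S k) -> (S #= `I_d)%card -> (size s <= d)%N.
Proof.
move=> us sS Sd; rewrite -card_le_II.
rewrite -(card_le_eqr Sd) -(card_le_eql (card_mem_uniq us)).
exact: subset_card_le.
Qed.

(** * Linear operators on a domain *)

Section LinearOperator.
Variables (R : realType) (X : normedModType R[i]) (D : set X) (T : X -> X).
Hypothesis TL : linear_operator D T.

Lemma linear_operator0 : T 0 = 0.
Proof.
have [D0 /(_ 1 0 0 D0 D0)[_]] := TL.
by rewrite !scale1r addr0 => /eqP; rewrite -[X in X == _]addr0 (inj_eq (addrI _)) eq_sym => /eqP.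
Qed.

Lemma linear_operatorZ a u : D u -> D (a *: u) /\ T (a *: u) = a *: T u.
Proof.
have [D0 TP] := TL; move=> Du; have := TP a u 0 Du D0.
by rewrite linear_operator0 !addr0.
Qed.

Lemma linear_operatorB u v : D u -> D v -> D (u - v) /\ T (u - v) = T u - T v.
Proof.
have [D0 TP] := TL; move=> Du Dv; have := TP (-1) v u Dv Du.
by rewrite !scaleN1r ![- _ + _]addrC.
Qed.

Lemma linear_operator_sum (I : Type) (r : seq I) (a : I -> R[i]) (x : I -> X) :
  (forall i, D (x i)) ->
  D (\sum_(i <- r) a i *: x i) /\
  T (\sum_(i <- r) a i *: x i) = \sum_(i <- r) a i *: T (x i).
Proof.
have [D0 TP] := TL; move=> Dx; elim: r => [|i r [Dr Tr]].
  by rewrite !big_nil linear_operator0.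
by rewrite !big_cons -Tr; exact: TP.
Qed.

End LinearOperator.

Lemma linear_operatorD (R : realType) (X : normedModType R[i]) (D : set X) (T S : X -> X) :
  linear_operator D T -> linear_operator D S -> linear_operator D (T \+ S).
Proof.
move=> [D0 TP] [_ SP]; split=> // a u v Du Dv /=.
have [Duv ->] := TP a u v Du Dv; have [_ ->] := SP a u v Du Dv.
by split=> //=; rewrite scalerDr addrACA.
Qed.

(** * Orthonormal families and eigenvectors of symmetric operators *)

Section Orthonormal.
Variables (R : realType) (X : normedModType R[i]) (ip : {dot X for Num.conj}).
Hypothesis ip_norm : is_inner_product ip.

(** Were q > p, the coefficient rows of the [x i] would be dependent; pairing the resulting
    vanishing combination with each [x i] kills its coefficients. *)
Lemma orthonormal_span_le p q (x : 'I_q -> X) (b : 'I_p -> X) :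
  (forall i j, ip (x i) (x j) = (i == j)%:R) ->
  (forall i, exists c : 'I_p -> R[i], x i = \sum_j c j *: b j) -> (q <= p)%N.
Proof.
move=> xo /choice[c xE]; rewrite leqNgt; apply/negP => pq.
have [a a0 aM] := rV_kernel_neq0 (\matrix_(i < q, j < p) c i j) pq.
have ax0 : \sum_i a 0 i *: x i = 0.
  under eq_bigr do rewrite xE scaler_sumr.
  rewrite exchange_big big1 //= => j _.
  under eq_bigr do rewrite scalerA.
  rewrite -scaler_suml; move/matrixP: aM => /(_ 0 j); rewrite !mxE.
  by under eq_bigr do rewrite mxE; move=> ->; rewrite scale0r.
case/eqP: a0; apply/rowP => i; rewrite [RHS]mxE.
by rewrite -(ip_suml_orthonormal xo (a 0)) ax0 linear0l.
Qed.

Lemma has_dim_orthonormal_le (E : set X) d q (x : 'I_q -> X) :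
  has_dim E d -> (forall i j, ip (x i) (x j) = (i == j)%:R) ->
  (forall i, E (x i)) -> (q <= d)%N.
Proof.
move=> [b [_ ->]] xo xE; apply: (orthonormal_span_le xo (b := b)) => i.
by have [c _ <-] := xE i; exists c.
Qed.

Variables (D : set X) (T : X -> X).
Hypotheses (TL : linear_operator D T) (TS : symmetric_on ip D T).

Lemma eigen_orthogonal (l m : R) (u v : X) :
  eigenspace D T l%:C u -> eigenspace D T m%:C v -> l != m -> ip u v = 0.
Proof.
move=> [Du Tu] [Dv Tv] lm; have := TS Du Dv.
rewrite Tu Tv linearZl_LR linearZr_LR /= conj_real_complex => /eqP.
rewrite -subr_eq0 -mulrBl mulf_eq0 subr_eq0 => /orP[/eqP[]/eqP|/eqP//].
by rewrite (negPf lm).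
Qed.

(* Subtracting from w its projection on the e j only removes components with
   m j = l, so the result is still an eigenvector for l. *)
Lemma eigenvector_orthogonalize n (e : 'I_n -> X) (m : 'I_n -> R) (l : R) (w : X) :
  (forall i j, ip (e i) (e j) = (i == j)%:R) ->
  (forall i, eigenspace D T (m i)%:C (e i)) -> eigenspace D T l%:C w ->
  (~ exists c : 'I_n -> R[i], w = \sum_j c j *: e j) ->
  exists v, [/\ eigenspace D T l%:C v, ip v v = 1 & forall j, ip v (e j) = 0].
Proof.
move=> eo eE wE we; pose p := \sum_j ip w (e j) *: e j; pose v := w - p.
have pE : eigenspace D T l%:C p.
  have De j : D (e j) by have [] := eE j.
  have [Dp Tp] := linear_operator_sum TL (index_enum _) (fun j => ip w (e j)) De.
  split=> //; rewrite Tp scaler_sumr; apply: eq_bigr => j _.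
  have [_ ->] := eE j; rewrite !scalerA.
  have [->|lm] := eqVneq l (m j); first by rewrite mulrC.
  by rewrite (eigen_orthogonal wE (eE j) lm) mul0r mulr0.
have vE : eigenspace D T l%:C v.
  have [[Dw Tw] [Dp Tp]] := (wE, pE).
  by have [Dv Tv] := linear_operatorB TL Dw Dp; split=> //; rewrite Tv Tw Tp scalerBr.
have v0 : `|v| != 0.
  rewrite normr_eq0 subr_eq0; apply/eqP => wp; apply: we.
  by exists (fun j => ip w (e j)).
exists (`|v|^-1 *: v); split.
- have [Dv Tv] := vE; have [? Tv'] := linear_operatorZ TL `|v|^-1 Dv.
  by split=> //; rewrite Tv' Tv !scalerA mulrC.
- by rewrite dnormZ ip_norm normrV ?unitfE // normr_id -exprMn mulVf // expr1n.
- move=> j; have pe : ip p (e j) = ip w (e j) by exact: ip_suml_orthonormal eo _ _.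
  have vE0 : ip v (e j) = ip w (e j) - ip p (e j) by exact: linearBl.
  by rewrite linearZl_LR /= vE0 pe subrr mulr0.
Qed.

End Orthonormal.

(** * Eigenvalues listed with multiplicity *)

Section EigenvalueSequence.
Variables (R : realType) (X : normedModType R[i]) (ip : {dot X for Num.conj}).
Hypothesis ip_norm : is_inner_product ip.
Variables (D : set X) (T : X -> X) (m : nat -> R).
Hypotheses (TL : linear_operator D T) (TS : symmetric_on ip D T).
Hypothesis mT : eigenvalues_with_multiplicity D T m.

(** Indexing by [nat], with only the first [n] vectors constrained, lets a family be extended by
    changing its value at [n]. *)
Definition eigenfamily n (e : nat -> X) :=
  (forall i j, (i < n)%N -> (j < n)%N -> ip (e i) (e j) = (i == j)%:R) /\
  (forall i, (i < n)%N -> eigenspace D T (m i)%:C (e i)).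

Lemma extend_orthonormal n (e : nat -> X) v :
  (forall i j, (i < n)%N -> (j < n)%N -> ip (e i) (e j) = (i == j)%:R) ->
  ip v v = 1 -> (forall j : 'I_n, ip v (e j) = 0) ->
  let e' k := if k == n then v else e k in
  forall i j, (i < n.+1)%N -> (j < n.+1)%N -> ip (e' i) (e' j) = (i == j)%:R.
Proof.
move=> eo vv ve e' i j; rewrite !ltnS /e' => il jl.
have [iN|iN] := eqVneq i n; have [jN|jN] := eqVneq j n.
- by rewrite iN jN eqxx.
- have jn : (j < n)%N by rewrite ltn_neqAle jN.
  by rewrite (ve (Ordinal jn)) iN eq_sym (negPf jN).
- have iln : (i < n)%N by rewrite ltn_neqAle iN.
  by rewrite ipC (ve (Ordinal iln)) rmorph0 jN (negPf iN).
- by rewrite eo // ltn_neqAle ?iN ?jN.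
Qed.

(* If the eigenspace of m n were spanned by the e j already built, its dimension
   would be the number of j < n with m j = m n, forgetting the index n itself. *)
Lemma exists_eigenfamily n : exists e, eigenfamily n e.
Proof.
elim: n => [|n [e [eo eE]]]; first by exists (fun=> 0); split.
pose en (i : 'I_n) := e i.
have eno i j : ip (en i) (en j) = (i == j)%:R by exact: eo.
have [[w wE we]|Esub] := pselect (exists2 w, eigenspace D T (m n)%:C w &
    ~ exists c : 'I_n -> R[i], w = \sum_j c j *: en j).
  have [v [vE vv ve]] := eigenvector_orthogonalize ip_norm TL TS eno
     (fun i : 'I_n => eE i (ltn_ord i)) wE we.
  exists (fun k => if k == n then v else e k); split.
    exact: extend_orthonormal.
  move=> i; rewrite ltnS; have [-> //|iN il] := eqVneq i n.
  by apply: eE; rewrite ltn_neqAle iN.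
exfalso; pose s := [seq k <- iota 0 n | m k == m n].
have us : uniq s by rewrite filter_uniq // iota_uniq.
have sP k : k \in s = (m k == m n) && (k < n)%N.
  by rewrite mem_filter mem_iota add0n.
pose h (i : 'I_(size s)) := nth 0%N s i.
have hs i : (m (h i) == m n) && (h i < n)%N by rewrite -sP mem_nth.
pose b i := e (h i).
have bo i j : ip (b i) (b j) = (i == j)%:R.
  have /andP[_ ?] := hs i; have /andP[_ ?] := hs j.
  by rewrite eo // nth_uniq.
have bE i : eigenspace D T (m n)%:C (b i).
  by have /andP[/eqP <- ?] := hs i; exact: eE.
have : has_dim (eigenspace D T (m n)%:C) (size s).
  exists b; split.
    by move=> c c0 i; rewrite -(ip_suml_orthonormal bo c) c0 linear0l.
  rewrite eqEsubset; split=> [w wE|w [c _ <-]]; last first.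
    have Db i : D (b i) by have [] := bE i.
    have [Dw Tw] := linear_operator_sum TL (index_enum _) c Db.
    split=> //; rewrite Tw scaler_sumr; apply: eq_bigr => i _.
    by have [_ ->] := bE i; rewrite !scalerA mulrC.
  have [c wc] : exists c : 'I_n -> R[i], w = \sum_j c j *: en j.
    by apply: contrapT => nc; apply: Esub; exists w.
  have cE j : c j = ip w (en j) by rewrite wc (ip_suml_orthonormal eno).
  exists (fun i => ip w (b i)) => //.
  (* Only the terms with [m k = m n] survive, eigenvectors for distinct eigenvalues being
     orthogonal. *)
  rewrite [RHS]wc; under [RHS]eq_bigr do rewrite cE.
  rewrite -(big_mkord xpredT (fun j => ip w (e j) *: e j)) /index_iota subn0.
  rewrite (bigID (fun k => m k == m n)) /= [X in _ + X]big1_seq ?addr0; last first.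
    move=> k /andP[mk]; rewrite mem_iota add0n => kn.
    by rewrite (eigen_orthogonal TS wE (eE _ kn)) ?scale0r // eq_sym.
  by rewrite -[RHS]big_filter (big_nth 0%N) big_mkord.
(* The dimension [size s] counts all occurrences of [m n], yet [n :: s] lists one more of them. *)
move=> /(mT.2 _ _).1 cs.
have /= := @size_uniq_le_card (n :: s) _ _ _ _ cs.
rewrite us sP ltnn andbF => H; suff : (size s < size s)%N by rewrite ltnn.
apply: H => //.
by move=> k; rewrite inE sP => /orP[/eqP -> //|/andP[/eqP <-]].
Qed.

(** If c < [m n], some [v i] lies outside the span of the [n] vectors [e j]; orthogonalizing it
    gives an eigenvector [w] for [l i]. All occurrences of [l i] in [m] have index below [n], so
    their [e k] together with [w] outnumber the dimension of that eigenspace. *)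
Lemma eigenvalue_le n (v : 'I_n.+1 -> X) (l : 'I_n.+1 -> R) (c : R) :
  (forall i j, ip (v i) (v j) = (i == j)%:R) ->
  (forall i, eigenspace D T (l i)%:C (v i)) -> (forall i, l i <= c) -> m n <= c.
Proof.
move=> vo vE lc; rewrite leNgt; apply/negP => cm.
have [e [eo eE]] := exists_eigenfamily n.
pose en (i : 'I_n) := e i.
have eno i j : ip (en i) (en j) = (i == j)%:R by exact: eo.
have [i vi] : exists i, ~ exists a : 'I_n -> R[i], v i = \sum_j a j *: en j.
  apply/existsNP => vs; have := orthonormal_span_le vo vs.
  by rewrite ltnn.
have [w [wE ww we]] := eigenvector_orthogonalize ip_norm TL TS eno
     (fun i : 'I_n => eE i (ltn_ord i)) (vE i) vi.
pose s := [seq k <- iota 0 n | m k == l i].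
have us : uniq s by rewrite filter_uniq // iota_uniq.
have sP k : k \in s = (m k == l i) && (k < n)%N.
  by rewrite mem_filter mem_iota add0n.
have sE : [set k | (m k)%:C = (l i)%:C] = [set k | k \in s].
  rewrite eqEsubset; split=> k /=; rewrite sP; last by case/andP => /eqP ->.
  move=> [mk]; rewrite mk eqxx ltnNge; apply/negP => nk.
  have := le_lt_trans (lc i) cm; rewrite ltNge -mk => /negP; apply.
  exact: mT.1.
have Ed : has_dim (eigenspace D T (l i)%:C) (size s).
  by apply/mT.2; rewrite sE; exact: card_mem_uniq.
pose e' k := if k == n then w else e k.
have e'o := extend_orthonormal eo ww we; rewrite -/e' in e'o.
have nsU : uniq (n :: s) by rewrite /= us sP ltnn andbF.
have nsP (k : 'I_(size s).+1) : nth 0%N (n :: s) k \in n :: s by exact: mem_nth.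
have := @has_dim_orthonormal_le _ _ ip _ _ _
  (fun k : 'I_(size s).+1 => e' (nth 0%N (n :: s) k)) Ed.
move=> H; suff : (size s < size s)%N by rewrite ltnn.
apply: H.
- move=> j k; have lt (q : 'I_(size s).+1) : (nth 0%N (n :: s) q < n.+1)%N.
    have := nsP q; rewrite inE sP => /orP[/eqP -> //|/andP[_]].
    by move=> /ltnW.
  by rewrite e'o ?lt // nth_uniq.
- move=> k; have := nsP k; rewrite inE sP /e' => /orP[->//|/andP[/eqP mk kn]].
  by rewrite (ltn_eqF kn) -mk; exact: eE.
Qed.

End EigenvalueSequence.

(** Compactness is stated on unit balls; dividing by a bound [r] covers other bounded families. *)
Lemma precompact_scaled_ultra_cvg (R : realType) (X : normedModType R[i]) (P : set X)
    (S : Type) (U : set_system S) (f : S -> X) (r : R[i]) :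
  UltraFilter U -> precompact P -> r != 0 -> (\forall s \near U, P (r^-1 *: f s)) ->
  exists x : X, f s @[s --> U] --> x.
Proof.
move=> UU cP r0 /(precompact_ultra_cvg UU cP)[x fx].
exists (r *: x).
have -> : f = (fun s => r *: (r^-1 *: f s)).
  by apply/funext => s; rewrite scalerA divff // scale1r.
by apply: cvgZ fx; exact: cvg_cst.
Qed.

(** * Expansions in an orthonormal basis *)

Section Basis.
Variables (R : realType) (X : normedModType R[i]) (ip : {dot X for Num.conj}).
Hypothesis ip_norm : is_inner_product ip.
Variable phi : nat -> X.
Hypothesis phi_basis : orthonormal_basis ip phi.

Lemma orthonormal_basis_eq x y : (forall k, ip x (phi k) = ip y (phi k)) -> x = y.
Proof.
move=> xy; apply: (norm_cvg_unique (phi_basis.2 x)).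
suff -> : (fun k => ip x (phi k) *: phi k) = (fun k => ip y (phi k) *: phi k).
  exact: phi_basis.2.
by apply/funext => k; rewrite xy.
Qed.

(** Pairing [x] with the partial sums of [y] gives sums of nonnegative terms converging to [ip x y].
    Inequalities between forms thus reduce to coefficients. *)
Lemma ip_ge0_basis x y :
  (forall k, 0 <= ip x (phi k) * (ip y (phi k))^*) -> 0 <= ip x y.
Proof.
move=> xy0.
apply: (cvg_complex_ge0 (ip_cvg ip_norm (cvg_cst x) (phi_basis.2 y))).
apply: nearW => N; rewrite /series /= linear_sumr sumr_ge0 // => k _.
by rewrite linearZr_LR /= mulrC; exact: xy0.
Qed.

End Basis.

(** * Symmetric operators diagonal in the basis *)

Section DiagonalOperator.
Variables (R : realType) (X : normedModType R[i]) (ip : {dot X for Num.conj}).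
Hypothesis ip_norm : is_inner_product ip.
Variables (D : set X) (A : X -> X) (mu : nat -> R) (phi : nat -> X).
Hypothesis A_symmetric : symmetric_on ip D A.
Hypotheses (mu_gt0 : forall k, 0 < mu k) (mu_nd : nondecreasing_seq mu).
Hypothesis phi_basis : orthonormal_basis ip phi.
Hypothesis phi_eigen : forall k, D (phi k) /\ A (phi k) = (mu k)%:C *: phi k.

Lemma ip_eigenbasis u k : D u -> ip (A u) (phi k) = (mu k)%:C * ip u (phi k).
Proof.
move=> Du; have [Dk Ak] := phi_eigen k.
by rewrite (A_symmetric Du Dk) Ak linearZr_LR /= conj_real_complex.
Qed.

(** The coefficients of A u - mu_n u and u multiply to (mu_k - mu_n) |u_k|^2, which is 0 for k < n
    and nonnegative beyond. *)
Lemma form_ge_eigenvalue n u : D u -> (forall k, (k < n)%N -> ip u (phi k) = 0) ->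
  (mu n)%:C * ip u u <= ip (A u) u.
Proof.
move=> Du un; rewrite -subr_ge0.
have -> : ip (A u) u - (mu n)%:C * ip u u = ip (A u - (mu n)%:C *: u) u.
  by rewrite linearBl linearZl_LR.
apply: (ip_ge0_basis ip_norm phi_basis) => k.
rewrite linearBl linearZl_LR /= ip_eigenbasis //.
rewrite -mulrBl -mulrA -normCK.
have [kn|nk] := ltnP k n; first by rewrite un // normr0 expr0n mulr0.
by rewrite mulr_ge0 ?exprn_ge0 // -rmorphB /= ler0c subr_ge0 mu_nd.
Qed.

(** By symmetry c^2 |u|^2 - |A u|^2 is the inner product of c u - A u and c u + A u, whose
    coefficients multiply to (c - mu_k)(c + mu_k) |u_k|^2. Unboundedness of [A] will thus force that
    of [mu]. *)
Lemma bounded_of_bounded_eigenvalues (c : R) : (forall k, mu k <= c) ->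
  forall u, D u -> `|A u| <= c%:C * `|u|.
Proof.
move=> muc u Du.
have c0 : 0 <= c := le_trans (ltW (mu_gt0 0)) (muc 0%N).
rewrite -(@ler_pXn2r _ 2) ?nnegrE ?mulr_ge0 ?ler0c // exprMn -!ip_norm -subr_ge0.
have -> : c%:C ^+ 2 * ip u u - ip (A u) (A u) = ip (c%:C *: u - A u) (c%:C *: u + A u).
  rewrite linearBl !linearDr !linearZl_LR !linearZr_LR /= conj_real_complex.
  rewrite (A_symmetric Du Du) -[X in X + _ - _]/(c%:C * (c%:C * ip u u)); ring.
apply: (ip_ge0_basis ip_norm phi_basis) => k.
have -> : ip (c%:C *: u - A u) (phi k) = (c - mu k)%:C * ip u (phi k).
  by rewrite linearBl linearZl_LR /= ip_eigenbasis // -mulrBl -rmorphB.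
have -> : ip (c%:C *: u + A u) (phi k) = (c + mu k)%:C * ip u (phi k).
  by rewrite linearDl linearZl_LR /= ip_eigenbasis // -mulrDl -rmorphD.
rewrite rmorphM /= conj_real_complex mulrACA -normCK.
rewrite mulr_ge0 ?exprn_ge0 // -rmorphM /= ler0c mulr_ge0 //.
  by rewrite subr_ge0.
by rewrite addr_ge0 // ltW.
Qed.

End DiagonalOperator.

(** * Relative bound of [K] with respect to [A] *)

Section RelativeBound.
Variables (R : realType) (X : normedModType R[i]) (ip : {dot X for Num.conj}).
Hypothesis ip_norm : is_inner_product ip.
Variables (D : set X) (A K : X -> X) (mu : nat -> R) (phi : nat -> X).
Hypotheses (A_linear : linear_operator D A) (A_positive : positive_on ip D A).
Hypothesis phi_basis : orthonormal_basis ip phi.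
Hypothesis phi_eigen : forall k, D (phi k) /\ A (phi k) = (mu k)%:C *: phi k.
Hypotheses (K_linear : linear_operator D K) (K_symmetric : symmetric_on ip D K).
Hypothesis K_compact : compact_operator D (fun u => `|A u|) K.

(* Were it false, there would be v n in the unit ball of D(A) with |K (v n)| >= eps
   and v n -> 0; a limit w of K (v n) satisfies ip w (phi k) = lim ip (v n) (K (phi k)) = 0. *)
Lemma relative_bound (eps : R) : 0 < eps ->
  exists2 c : R, 0 <= c & forall u, D u -> `|K u| <= eps%:C * `|A u| + c%:C * `|u|.
Proof.
move=> eps0; apply: contrapT => nb.
have /choice[v vP] : forall n, exists v, [/\ D v, `|A v| <= 1, eps%:C <= `|K v| &
    `|v| <= ((harmonic n : R)%:C) * `|K v|].
  move=> n; have [u [Du Ku]] : exists u, D u /\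
      eps%:C * `|A u| + (n.+1%:R : R)%:C * `|u| < `|K u|.
    apply: contrapT => nu; apply: nb; exists n.+1%:R => // u Du.
    rewrite real_leNgt ?normr_real //; last first.
      by rewrite realD // realM ?normr_real ?complex_real.
    by apply/negP => ?; apply: nu; exists u.
  have Au0 : 0 < `|A u|.
    rewrite normr_gt0; apply/eqP => Au0.
    have u0 : u = 0.
      apply/eqP/negPn/negP => u0; have := A_positive Du u0.
      by rewrite Au0 linear0l ltxx.
    move: Ku; rewrite u0 (linear_operator0 K_linear) (linear_operator0 A_linear).
    by rewrite !normr0 !mulr0 addr0 ltxx.
  (* Scaling to |A v| = 1 turns the failed bound into eps + (n + 1) |v| < |K v|, which contains both
     remaining estimates. *)
  pose t := `|A u|^-1; have t0 : 0 < t by rewrite invr_gt0.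
  have [Dv Av] := linear_operatorZ A_linear t Du.
  have [_ Kv] := linear_operatorZ K_linear t Du.
  have n0 : 0 < (n.+1%:R : R)%:C by rewrite ltcR.
  exists (t *: u); split => //.
  - by rewrite Av normrZ gtr0_norm // mulVf // gt_eqF.
  - rewrite Kv normrZ gtr0_norm // mulrC -ler_pdivrMr // /t invrK.
    apply: le_trans (ltW Ku); rewrite lerDl mulr_ge0 // ltW //.
  - rewrite Kv !normrZ !(gtr0_norm t0) mulrCA ler_pM2l // /harmonic /=.
    rewrite fmorphV /= ler_pdivlMl //; apply: le_trans (ltW Ku).
    by rewrite lerDr mulr_ge0 // ler0c ltW.
have [U [UU oU]] := ultraFilterLemma eventually_filter.
have vD n : D (v n) by have [] := vP n.
have [w Kw] : exists w : X, K (v n) @[n --> U] --> w.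
  apply: (precompact_ultra_cvg UU K_compact); apply: nearW => n.
  by have [? ? _ _] := vP n; exists (v n).
have w_ge : eps%:C <= `|w|.
  rewrite -subr_ge0; apply: (@cvg_complex_ge0 _ _ U _ (fun n => `|K (v n)| - eps%:C)).
    by apply: cvgB; [exact: cvg_norm|exact: cvg_cst].
  by apply: nearW => n; rewrite subr_ge0; have [] := vP n.
have v0 : v n @[n --> U] --> 0.
  have h0 : (((harmonic n : R)%:C) * `|K (v n)| : R[i]^o) @[n --> U] --> (0 : R[i]^o).
    rewrite -(mul0r `|w|); apply: cvgM; last exact: cvg_norm.
    apply: (@cvg_real_complex _ _ _ _ harmonic 0).
    by apply: cvg_trans (@cvg_harmonic R); exact: cvg_app.
  apply/cvgr0Pnorm_lt => e e0; move: h0 => /cvgr0Pnorm_lt/(_ e e0); apply: filterS => n.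
  apply: le_lt_trans; have [_ _ _ /le_trans] := vP n; apply.
  by rewrite real_ler_norm // realM ?normr_real ?complex_real.
move: w_ge; suff -> : w = 0 by rewrite normr0 lecR leNgt eps0.
apply: (orthonormal_basis_eq phi_basis) => k; have [Dk _] := phi_eigen k.
rewrite linear0l -(linear0l ip (K (phi k))).
apply: (ip_cvg_eq ip_norm Kw v0); apply: nearW => n.
exact: K_symmetric.
Qed.

End RelativeBound.

(** * Galerkin approximation of eigenvectors *)

Section Galerkin.
Variables (R : realType) (X : normedModType R[i]) (ip : {dot X for Num.conj}).
Hypothesis ip_norm : is_inner_product ip.
Variables (D : set X) (A K : X -> X) (mu : nat -> R) (phi : nat -> X).
Hypotheses (A_linear : linear_operator D A) (A_symmetric : symmetric_on ip D A).
Hypothesis A_positive : positive_on ip D A.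
Hypotheses (mu_gt0 : forall k, 0 < mu k) (mu_nd : nondecreasing_seq mu).
Hypothesis phi_orthonormal : forall i j, ip (phi i) (phi j) = (i == j)%:R.
Hypothesis phi_eigen : forall k, D (phi k) /\ A (phi k) = (mu k)%:C *: phi k.
Hypotheses (K_linear : linear_operator D K) (K_symmetric : symmetric_on ip D K).
Hypothesis K_nonnegative : nonnegative_on ip D K.

Let mu_ge0 k : 0 <= (mu k)%:C. Proof. by rewrite ler0c ltW. Qed.

(** On combinations of phi_0, ..., phi_n one has |A u| <= mu_n |u|; with the bound on [K],
    Cauchy-Schwarz then estimates the two forms separately. *)
Lemma form_le_eigenvalue N n (eps c : R) (a : 'I_N -> R[i]) (u := \sum_k a k *: phi k) :
  0 <= eps -> (forall v, D v -> `|K v| <= eps%:C * `|A v| + c%:C * `|v|) ->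
  (forall k : 'I_N, (n < k)%N -> a k = 0) ->
  ip ((A \+ K) u) u <= (mu n * (1 + eps) + c)%:C * ip u u.
Proof.
move=> eps0 Kb an.
have phio (i j : 'I_N) : ip (phi i) (phi j) = (i == j)%:R by exact: phi_orthonormal.
have [Du Au] : D u /\ A u = \sum_k (a k * (mu k)%:C) *: phi k.
  have [Du ->] := linear_operator_sum A_linear (index_enum 'I_N) a (fun k => (phi_eigen k).1).
  by split=> //; apply: eq_bigr => k _; rewrite (phi_eigen k).2 scalerA.
have mua (k : 'I_N) : `|a k * (mu k)%:C| <= (mu n)%:C * `|a k|.
  have [kn|nk] := leqP k n; last by rewrite an // mul0r normr0 mulr0.
  rewrite normrM mulrC ler_wpM2r // ger0_norm; last by rewrite ler0c ltW.
  by rewrite lecR mu_nd.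
have Ale : `|A u| <= (mu n)%:C * `|u|.
  rewrite -(@ler_pXn2r _ 2) ?nnegrE ?mulr_ge0 // exprMn Au.
  rewrite !(normr_sum_orthonormal ip_norm phio) mulr_sumr ler_sum // => k _.
  by rewrite -exprMn ler_pXn2r ?nnegrE ?mulr_ge0.
have -> : (mu n * (1 + eps) + c)%:C * ip u u =
    ((mu n)%:C * `|u|) * `|u| + (eps%:C * ((mu n)%:C * `|u|) + c%:C * `|u|) * `|u|.
  rewrite ip_norm !(rmorphD, rmorphM) /=; ring.
rewrite linearDl lerD //.
  apply: le_trans (real_ler_norm _) _; last first.
    by apply: le_trans (ip_cauchy_schwarz ip_norm _ _) _; rewrite ler_wpM2r.
  by apply/ger0_real; have [->|/(A_positive Du)/ltW//] := eqVneq u 0; rewrite linear0r.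
apply: le_trans (real_ler_norm _) _; first exact/ger0_real/K_nonnegative.
apply: le_trans (ip_cauchy_schwarz ip_norm _ _) _; rewrite ler_wpM2r //.
by apply: le_trans (Kb u Du) _; rewrite lerD2r ler_wpM2l // ler0c.
Qed.

(** The compression of A + K to the span of phi_0, ..., phi_(N-1) is a Hermitian matrix, to which
    [ritz_vectors] applies. The last bound is independent of [N], so compactness can be used as [N]
    grows. *)
Lemma galerkin_eigenvectors N n (c M : R) : (n < N)%N ->
  (forall a : 'I_N -> R[i], (forall k : 'I_N, (n < k)%N -> a k = 0) ->
    ip ((A \+ K) (\sum_k a k *: phi k)) (\sum_k a k *: phi k) <=
      c%:C * ip (\sum_k a k *: phi k) (\sum_k a k *: phi k)) ->
  (forall v, D v -> `|K v| <= 2^-1%:C * `|A v| + M%:C * `|v|) ->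
  exists (v : 'I_n.+1 -> X) (l : 'I_n.+1 -> R),
    [/\ forall i j, ip (v i) (v j) = (i == j)%:R,
        forall i, D (v i),
        forall i k, (k < N)%N -> ip ((A \+ K) (v i)) (phi k) = (l i)%:C * ip (v i) (phi k),
        forall i, 0 <= l i <= c &
        forall i, `|A (v i)| <= (2 * (c + M))%:C].
Proof.
move=> nN formb Kb; pose B := A \+ K.
have phio (i j : 'I_N) : ip (phi i) (phi j) = (i == j)%:R by exact: phi_orthonormal.
have BL : linear_operator D B by exact: linear_operatorD.
have Dphi (k : 'I_N) : D (phi k) by have [] := phi_eigen k.
have BS : symmetric_on ip D B.
  by move=> u v Du Dv; rewrite ipDl ipDr A_symmetric ?K_symmetric.
pose H : 'M[R[i]]_N := \matrix_(j, k) ip (B (phi j)) (phi k).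
pose em (x : 'rV[R[i]]_N) := \sum_k x 0 k *: phi k.
have emD x : D (em x).
  by have [] := linear_operator_sum BL (index_enum 'I_N) (x 0) Dphi.
have emB x (k : 'I_N) : ip (B (em x)) (phi k) = (x *m H) 0 k.
  have [_ ->] := linear_operator_sum BL (index_enum 'I_N) (x 0) Dphi.
  rewrite linear_sumlz mxE; apply: eq_bigr => j _.
  by rewrite linearZl_LR mxE.
have ip_em u x : ip u (em x) = \sum_(k < N) ip u (phi k) * (x 0 k)^*.
  by rewrite linear_sumr; apply: eq_bigr => k _; rewrite linearZr_LR /= mulrC.
have Hherm : H \is hermsymmx.
  apply/is_hermitianmxP; rewrite expr0 scale1r; apply/matrixP => j k; rewrite !mxE.
  by rewrite BS // ipC.
have cR : c%:C \is Num.real by rewrite complex_real.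
have [|V [l [Vu VH lc]]] := ritz_vectors nN Hherm cR.
  move=> x xn; have -> : (x *m H *m (x ^t* )%sesqui) 0 0 = ip (B (em x)) (em x).
    by rewrite mulmx_trC_row ip_em; under [RHS]eq_bigr do rewrite emB.
  have -> : (x *m (x ^t* )%sesqui) 0 0 = ip (em x) (em x).
    rewrite mulmx_trC_row ip_em; apply: eq_bigr => k _.
    by rewrite (ip_suml_orthonormal phio).
  exact: formb.
pose v i := em (row i V).
have vo i j : ip (v i) (v j) = (i == j)%:R.
  have /matrixP/(_ i j) := unitarymxP Vu; rewrite !mxE => <-.
  rewrite ip_em; apply: eq_bigr => k _.
  by rewrite (ip_suml_orthonormal phio) !mxE.
have vN i : `|v i| = 1.
  by apply/eqP; rewrite -(@eqrXn2 _ 2) // expr1n -ip_norm vo eqxx.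
have vB i k : (k < N)%N -> ip (B (v i)) (phi k) = l 0 i * ip (v i) (phi k).
  move=> kN; rewrite (emB _ (Ordinal kN)) -row_mul VH.
  rewrite (ip_suml_orthonormal phio _ (Ordinal kN)).
  by rewrite mxE mul_diag_mx mxE [in RHS]mxE.
have vBem i x : ip (B (v i)) (em x) = l 0 i * ip (v i) (em x).
  by rewrite !ip_em mulr_sumr; apply: eq_bigr => k _; rewrite vB // mulrA.
have B0 u : D u -> 0 <= ip (B u) u.
  move=> Du; rewrite ipDl addr_ge0 ?K_nonnegative //.
  by have [->|/(A_positive Du)/ltW//] := eqVneq u 0; rewrite linear0r.
(* Testing against [v i] itself gives this lower bound, which also makes the complex number [l 0 i]
   real. *)
have l0 i : 0 <= l 0 i.
  by have := B0 _ (emD (row i V)); rewrite vBem vo eqxx mulr1.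
have lR i : l 0 i = (complex.Re (l 0 i))%:C by rewrite RRe_real // ger0_real.
exists v, (fun i => complex.Re (l 0 i)); split => //.
- by move=> i; exact: emD.
- by move=> i k kN; rewrite -lR vB.
- move=> i; apply/andP; split; first by rewrite -ler0c -lR l0.
  by rewrite -lecR -lR lc.
move=> i.
have Av : exists x, A (v i) = em x.
  exists (\row_k (V i k * (mu k)%:C)).
  have [_ ->] := linear_operator_sum A_linear (index_enum 'I_N) (row i V 0) Dphi.
  by apply: eq_bigr => k _; rewrite !mxE (phi_eigen k).2 scalerA.
(* The Galerkin equation may be tested against A (v i), which lies in the span. *)
have AA : `|A (v i)| ^+ 2 <= (l 0 i + `|K (v i)|) * `|A (v i)|.
  have [x xE] := Av.
  have <- : `|ip (l 0 i *: v i - K (v i)) (A (v i))| = `|A (v i)| ^+ 2.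
    rewrite ipBl linearZl_LR /= xE -vBem ipDl -xE addrK ip_norm.
    by rewrite ger0_norm ?exprn_ge0.
  apply: le_trans (ip_cauchy_schwarz ip_norm _ _) _; rewrite ler_wpM2r //.
  by apply: le_trans (ler_normB _ _) _; rewrite normrZ vN mulr1 ger0_norm.
have A1 : `|A (v i)| <= l 0 i + `|K (v i)|.
  have [->|A0] := eqVneq `|A (v i)| 0; first by rewrite addr_ge0.
  by move: AA; rewrite expr2 ler_pM2r // lt_def A0 normr_ge0.
(* The coefficient 1/2 lets |A v| be absorbed on the left: |A v| <= c + |A v| / 2 + M. *)
have := le_trans A1 (lerD (lc i) (Kb _ (emD _))).
have -> : `|A (v i)| = (complex.Re `|A (v i)|)%:C by rewrite RRe_real // normr_real.
rewrite vN mulr1 -!rmorphM -!rmorphD /= !lecR; lra.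
Qed.

End Galerkin.

(** * Comparison of the eigenvalues of A + K with those of A *)

Section Perturbation.
Variables (R : realType) (X : normedModType R[i]) (ip : {dot X for Num.conj}).
Hypothesis ip_norm : is_inner_product ip.
Variables (D : set X) (A K : X -> X) (mu : nat -> R) (phi : nat -> X).
Hypotheses (A_linear : linear_operator D A) (A_symmetric : symmetric_on ip D A).
Hypothesis A_positive : positive_on ip D A.
Hypothesis A_compact_resolvent : compact_resolvent D A.
Hypothesis A_surjective : forall x, exists2 u, D u & A u = x.
Hypotheses (mu_gt0 : forall k, 0 < mu k) (mu_nd : nondecreasing_seq mu).
Hypothesis phi_basis : orthonormal_basis ip phi.
Hypothesis phi_eigen : forall k, D (phi k) /\ A (phi k) = (mu k)%:C *: phi k.
Hypotheses (K_linear : linear_operator D K) (K_symmetric : symmetric_on ip D K).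
Hypothesis K_nonnegative : nonnegative_on ip D K.
Hypothesis K_compact : compact_operator D (fun u => `|A u|) K.

(** [v N] is the image of (A - l) (v N) under the compact resolvent, and [K] is compact on D(A): up
    to scaling, both sequences lie in precompact sets. *)
Lemma graph_bounded_ultra_cvg (U : set_system nat) (v : nat -> X) (M : R) :
  UltraFilter U -> (forall N, D (v N)) -> (forall N, `|v N| <= 1) ->
  (forall N, `|A (v N)| <= M%:C) ->
  (exists u : X, v N @[N --> U] --> u) /\ (exists w : X, K (v N) @[N --> U] --> w).
Proof.
move=> UU vD v1 vM.
have Mle : M%:C <= (`|M| + 1)%:C by rewrite lecR ler_wpDr // ler_norm.
have M0 : 0 < (`|M| + 1)%:C by rewrite ltcR ltr_wpDl.
split.
- have [l [S [[_ _ SK] Sc]]] := A_compact_resolvent.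
  pose r := (`|M| + 1)%:C + `|l|.
  have r0 : 0 < r by rewrite ltr_wpDr.
  apply: (precompact_scaled_ultra_cvg UU Sc (lt0r_neq0 r0)); apply: nearW => N.
  have [Dv Av] := linear_operatorZ A_linear r^-1 (vD N).
  exists (A (r^-1 *: v N) - l *: (r^-1 *: v N)); last exact: SK.
  split=> //=; rewrite Av scalerA mulrC -scalerA -scalerBr normrZ.
  rewrite gtr0_norm ?invr_gt0 // mulrC ler_pdivrMr // mul1r.
  apply: le_trans (ler_normB _ _) _; rewrite lerD //.
    exact: le_trans (vM N) Mle.
  by rewrite normrZ ler_piMr.
- apply: (precompact_scaled_ultra_cvg UU K_compact (lt0r_neq0 M0)); apply: nearW => N.
  have [Dv Av] := linear_operatorZ A_linear (`|M| + 1)%:C^-1 (vD N).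
  have [_ Kv] := linear_operatorZ K_linear (`|M| + 1)%:C^-1 (vD N).
  exists ((`|M| + 1)%:C^-1 *: v N); last by [].
  split=> //=; rewrite Av normrZ gtr0_norm ?invr_gt0 // mulrC ler_pdivrMr // mul1r.
  exact: le_trans (vM N) Mle.
Qed.

Lemma eigenvectors_of_form_bound n (c : R) :
  (forall N (a : 'I_N -> R[i]), (forall k : 'I_N, (n < k)%N -> a k = 0) ->
    ip ((A \+ K) (\sum_k a k *: phi k)) (\sum_k a k *: phi k) <=
      c%:C * ip (\sum_k a k *: phi k) (\sum_k a k *: phi k)) ->
  exists (v : 'I_n.+1 -> X) (l : 'I_n.+1 -> R),
    [/\ forall i j, ip (v i) (v j) = (i == j)%:R,
        forall i, eigenspace D (A \+ K) (l i)%:C (v i) &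
        forall i, l i <= c].
Proof.
move=> formb.
have [M M0 KM] : exists2 M : R, 0 <= M &
    forall v, D v -> `|K v| <= 2^-1%:C * `|A v| + M%:C * `|v|.
  apply: (relative_bound ip_norm A_linear A_positive phi_basis phi_eigen
    K_linear K_symmetric K_compact).
  by rewrite invr_gt0.
(* The dimension N + n + 1 exceeds [n] for every [N]. *)
have G N := galerkin_eigenvectors ip_norm A_linear A_symmetric A_positive
  phi_basis.1 phi_eigen K_linear K_symmetric K_nonnegative
  (leq_addl N n.+1) (formb (N + n.+1)%N) KM.
have [v G'] := choice G; have [l vlP] := choice G'.
have [U [UU oU]] := ultraFilterLemma eventually_filter.
have vN N i : `|v N i| = 1.
  have [vo _ _ _ _] := vlP N.
  by apply/eqP; rewrite -(@eqrXn2 _ 2) // expr1n -ip_norm vo eqxx.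
have cvgv i : (exists u : X, v N i @[N --> U] --> u) /\
    (exists w : X, K (v N i) @[N --> U] --> w).
  apply: (@graph_bounded_ultra_cvg _ _ (2 * (c + M))) => N.
  - by have [] := vlP N.
  - by rewrite vN.
  - by have [] := vlP N.
have /choice[u vu] : forall i, exists u : X, v N i @[N --> U] --> u.
  by move=> i; have [] := cvgv i.
have /choice[w Kw] : forall i, exists w : X, K (v N i) @[N --> U] --> w.
  by move=> i; have [] := cvgv i.
have /choice[m lm] : forall i, exists m : R, m <= c /\ l N i @[N --> U] --> m.
  move=> i; have := @segment_compact R 0 c; rewrite compact_ultra.
  move=> /(_ _ (fmap_ultra (fun N => l N i) UU))[].
    apply: nearW => N; have [_ _ _ lc _] := vlP N.
    by rewrite /= in_itv /= lc.
  by move=> m [/=]; rewrite in_itv /= => /andP[_ mc] lm; exists m.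
exists u, m; split.
- move=> i j.
  apply: (@norm_cvg_unique _ R[i]^o ((fun N => ip (v N i) (v N j)) @ U)).
    exact: (ip_cvg ip_norm (vu i) (vu j)).
  have -> : (fun N => ip (v N i) (v N j)) = (fun=> (i == j)%:R).
    by apply/funext => N; have [-> _ _ _ _] := vlP N.
  exact: (@cvg_cst R[i]^o).
- move=> i; have [z Dz Az] := A_surjective ((m i)%:C *: u i - w i).
  (* z is the preimage by A of the limit of l v - K v; testing against phi k shows
     z = u i, whence u i lies in the domain. *)
  have zu : z = u i.
    apply: (orthonormal_basis_eq phi_basis) => k.
    have mu0 : (mu k)%:C != 0 by rewrite gt_eqF // ltcR.
    apply: (mulfI mu0); rewrite -(ip_eigenbasis A_symmetric phi_eigen) // Az.
    have -> : (mu k)%:C * ip (u i) (phi k) = ip (u i) ((mu k)%:C *: phi k).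
      by rewrite linearZr_LR /= conj_real_complex.
    apply: (ip_cvg_eq ip_norm (cvgB (cvgZ (cvg_real_complex (lm i).2) (vu i)) (Kw i)) (vu i)).
    (* The equation tested against phi_k holds once phi_k belongs to the Galerkin space, hence for
       all N >= k. *)
    apply: oU; exists k => // N /= kN.
    have [_ vD vB _ _] := vlP N.
    rewrite ipBl linearZl_LR /= -vB; last first.
      by rewrite addnS ltnS (leq_trans kN) ?leq_addr.
    rewrite ipDl addrK (ip_eigenbasis A_symmetric phi_eigen) //.
    by rewrite linearZr_LR /= conj_real_complex.
  (* K is not assumed closed: symmetry identifies the limit w i weakly. *)
  rewrite -zu; split=> //=; rewrite Az zu.
  suff -> : K (u i) = w i by rewrite subrK.
  apply: (orthonormal_basis_eq phi_basis) => k; have [Dk _] := phi_eigen k.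
  rewrite K_symmetric // -?zu //; apply/esym; rewrite zu.
  apply: (ip_cvg_eq ip_norm (Kw i) (vu i)); apply: nearW => N.
  by have [_ vD _ _ _] := vlP N; exact: K_symmetric.
- by move=> i; have [] := lm i.
Qed.

Variable mut : nat -> R.
Hypothesis mut_eigenvalues : eigenvalues_with_multiplicity D (A \+ K) mut.

Let AK_linear : linear_operator D (A \+ K).
Proof. exact: linear_operatorD. Qed.

Let AK_symmetric : symmetric_on ip D (A \+ K).
Proof. by move=> u v Du Dv; rewrite ipDl ipDr A_symmetric ?K_symmetric. Qed.

(** The constant depends on [eps] but not on [n], so it becomes negligible against mu_n. *)
Lemma perturbed_eigenvalue_le (eps : R) : 0 < eps ->
  exists c, forall n, mut n <= mu n * (1 + eps) + c.
Proof.
move=> eps0; have [c c0 Kc] := relative_bound ip_norm A_linear A_positive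
  phi_basis phi_eigen K_linear K_symmetric K_compact eps0.
exists c => n.
have [|v [l [vo vE lc]]] := @eigenvectors_of_form_bound n (mu n * (1 + eps) + c).
  move=> N a an.
  exact: (form_le_eigenvalue ip_norm A_linear A_positive mu_gt0 mu_nd
    phi_basis.1 phi_eigen K_nonnegative (ltW eps0) Kc an).
exact: (eigenvalue_le ip_norm AK_linear AK_symmetric mut_eigenvalues vo vE lc).
Qed.

(** Some nonzero [u] in the span of the first n + 1 eigenvectors of A + K is orthogonal to phi_0,
    ..., phi_(n-1). Then mu_n |u|^2 <= <A u, u> <= <(A + K) u, u> <= mut_n |u|^2. *)
Lemma eigenvalue_le_perturbed n : mu n <= mut n.
Proof.
have [e [eo eE]] := exists_eigenfamily ip_norm AK_linear AK_symmetric mut_eigenvalues n.+1.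
have eno (i j : 'I_n.+1) : ip (e i) (e j) = (i == j)%:R by exact: eo.
have eD (i : 'I_n.+1) : D (e i) by have [] := eE i (ltn_ord i).
have [a a0 aM] := rV_kernel_neq0 (\matrix_(i < n.+1, k < n) ip (e i) (phi k)) (ltnSn n).
pose u := \sum_(i < n.+1) a 0 i *: e i.
have [Du Bu] := linear_operator_sum AK_linear (index_enum 'I_n.+1) (a 0) eD.
rewrite -/u in Du Bu.
have un k : (k < n)%N -> ip u (phi k) = 0.
  move=> kn; move/matrixP: aM => /(_ 0 (Ordinal kn)); rewrite [RHS]mxE => <-.
  rewrite linear_sumlz mxE; apply: eq_bigr => i _.
  by rewrite linearZl_LR /= !mxE.
have uu : ip u u = \sum_i `|a 0 i| ^+ 2.
  by rewrite ip_norm (normr_sum_orthonormal ip_norm eno).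
have u0 : 0 < ip u u.
  rewrite uu lt_def sumr_ge0 ?andbT; last by move=> i _; rewrite exprn_ge0.
  rewrite psumr_eq0; last by move=> i _; rewrite exprn_ge0.
  apply: contra a0 => /allP a0; apply/eqP/rowP => i; rewrite mxE; apply/eqP.
  by have := a0 i (mem_index_enum _); rewrite /= expf_eq0 /= normr_eq0.
rewrite -lecR -(ler_pM2r u0).
apply: le_trans (form_ge_eigenvalue ip_norm A_symmetric mu_nd phi_basis phi_eigen Du un) _.
apply: (@le_trans _ _ (ip ((A \+ K) u) u)).
  by rewrite ipDl lerDl K_nonnegative.
have -> : (A \+ K) u = \sum_(i < n.+1) (a 0 i * (mut i)%:C) *: e i.
  by rewrite Bu; apply: eq_bigr => i _; have [_ ->] := eE i (ltn_ord i); rewrite scalerA.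
rewrite (ip_sum_orthonormal eno) uu mulr_sumr ler_sum // => i _.
rewrite mulrAC -normCK mulrC ler_wpM2r ?exprn_ge0 // lecR.
by apply: mut_eigenvalues.1; rewrite -ltnS.
Qed.

End Perturbation.

(** * Piecewise linear interpolation *)

Section Interpolation.
Variables (R : realType) (mu a : nat -> R).
Hypotheses (mu_increasing : increasing_seq mu) (mu_unbounded : forall c, exists n, c < mu n).

Let mu_le m n : (mu m <= mu n) = (m <= n)%N. Proof. exact: mu_increasing. Qed.
Let mu_lt m n : (mu m < mu n) = (m < n)%N.
Proof. by rewrite !ltNge mu_le ltnNge. Qed.

Definition ramp n (x : R) := Num.min 1 (Num.max 0 ((x - mu n) / (mu n.+1 - mu n))).

(** Weighting the increments by ramps gives continuity by induction on [N], without gluing pieces;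
    beyond mu_N the value stays at [a N]. *)
Definition ramp_sum N x := a 0%N + \sum_(0 <= n < N) (a n.+1 - a n) * ramp n x.

Let gap_gt0 n : 0 < mu n.+1 - mu n. Proof. by rewrite subr_gt0 mu_lt. Qed.

Lemma ramp_left n x : x <= mu n -> ramp n x = 0.
Proof.
move=> xn; rewrite /ramp max_l ?min_r //.
by rewrite pmulr_lle0 ?invr_gt0 // subr_le0.
Qed.

Lemma ramp_right n x : mu n.+1 <= x -> ramp n x = 1.
Proof.
move=> nx; have h : 1 <= (x - mu n) / (mu n.+1 - mu n).
  by rewrite ler_pdivlMr // mul1r lerB.
by rewrite /ramp max_r ?min_l // (le_trans _ h).
Qed.

Lemma ramp_itv n x : 0 <= ramp n x <= 1.
Proof. by rewrite /ramp le_min ler01 le_max lexx ge_min lexx. Qed.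

Lemma continuous_ramp_sum N : continuous (ramp_sum N).
Proof.
elim: N => [|N IHN] x.
  have -> : ramp_sum 0 = fun=> a 0%N.
    by apply/funext => y; rewrite /ramp_sum big_geq // addr0.
  exact: cvg_cst.
have -> : ramp_sum N.+1 = fun y => ramp_sum N y + (a N.+1 - a N) * ramp N y.
  by apply/funext => y; rewrite /ramp_sum big_nat_recr //= addrA.
apply: cvgD; first exact: IHN.
apply: cvgM; first exact: cvg_cst.
pose g y := (y - mu N) / (mu N.+1 - mu N) : R^o.
have gx : {for x, continuous g}.
  by apply: cvgM; [apply: cvgB; [exact: cvg_id|exact: cvg_cst]|exact: cvg_cst].
have cx (c : R^o) : {for x, continuous (fun=> c)} by exact: cvg_cst.
exact: (continuous_min (cx 1) (continuous_max (cx 0) gx)).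
Qed.

(** Ramps of index at least [N] vanish at [x], so any truncation beyond [x] gives the same value. *)
Lemma ramp_sum_stable N M x : x <= mu N -> x <= mu M -> ramp_sum N x = ramp_sum M x.
Proof.
wlog NM : N M / (N <= M)%N.
  by move=> h xN xM; have [/h|/ltnW/h] := leqP N M; [exact|move=> <-].
move=> xN _; rewrite /ramp_sum (big_cat_nat (leq0n N) NM) /=.
rewrite [X in _ = _ + (_ + X)](_ : _ = 0) ?addr0 // big_nat big1 // => n /andP[Nn _].
by rewrite ramp_left ?mulr0 // (le_trans xN) // mu_le.
Qed.

Lemma ramp_sum_telescope n x : mu n <= x -> ramp_sum n x = a n.
Proof.
move=> nx; rewrite /ramp_sum -(subrKC (a 0%N) (a n)) -(telescope_sumr _ (leq0n n)).
congr (_ + _); rewrite !big_nat; apply: eq_bigr => k /andP[_ kn].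
by rewrite ramp_right ?mulr1 // (le_trans _ nx) // mu_le.
Qed.

Lemma continuous_interpolation : a @ \oo --> 0 ->
  exists f : R -> R, [/\ continuous f, f x @[x --> +oo] --> 0 & forall n, f (mu n) = a n].
Proof.
move=> a0; have [N xN] := choice mu_unbounded.
pose f x := ramp_sum (N x) x.
have fE M x : x <= mu M -> f x = ramp_sum M x.
  by move=> xM; apply: ramp_sum_stable => //; exact: ltW.
exists f; split.
(* Points near [x] stay below mu_(N x), where [f] is one fixed ramp sum. *)
- move=> x; have : ramp_sum (N x) y @[y --> x] --> f x by exact: continuous_ramp_sum.
  apply: cvg_trans; apply: near_eq_cvg.
  near=> y; apply/esym/fE/ltW; near: y.
  exact: lt_nbhsl.
- apply/cvgr0Pnorm_lt => e e0.
  have [n0 _ an] : \forall n \near \oo, `|a n| < e by move: a0 => /cvgr0Pnorm_lt; apply.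
  near=> x.
  have n0x : mu n0 <= x by near: x; apply: nbhs_pinfty_ge; rewrite num_real.
  (* Minimality gives mu_n <= x < mu_(n+1); index 0 is excluded because mu_n0 <= x. *)
  have [[|n] xn nmin] := ex_minnP (mu_unbounded x).
    by move: (le_lt_trans n0x xn); rewrite mu_lt.
  have nx : mu n <= x.
    by rewrite leNgt; apply/negP => /nmin; rewrite ltnn.
  have n0n : (n0 <= n)%N by move: (le_lt_trans n0x xn); rewrite mu_lt.
  (* f x = a n + t (a (n+1) - a n) with t in [0, 1] is a convex combination of two values of modulus
     below e. *)
  rewrite (fE n.+1) ?ltW // /ramp_sum big_nat_recr //= addrA.
  rewrite -/(ramp_sum n x) ramp_sum_telescope //.
  have /andP[t0 t1] := ramp_itv n x; set t := ramp n x in t0 t1 *.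
  have h0 := an _ n0n; have h1 := an _ (leqW n0n); rewrite /= in h0 h1.
  move: h0 h1; rewrite !ltr_norml => /andP[? ?] /andP[? ?].
  by have [ab|ab] := leP (a n) (a n.+1); apply/andP; split; nra.
- by move=> n; rewrite (fE n) // ramp_sum_telescope.
Unshelve. all: by end_near. Qed.

End Interpolation.

Unset Implicit Arguments.

(* Sequences are indexed from 0: mu k, phi k and mut k stand for the
   (k+1)-st terms. *)
Theorem theorem3p1 (R : realType) (X : completeNormedModType R[i])
    (ip : {dot X for Num.conj}) (D : set X) (A K : X -> X)
    (mu : nat -> R) (phi : nat -> X) (mut : nat -> R)
    (ip_norm : is_inner_product ip)
    (X_infinite : infinite_dimensional X)
    (A_linear : linear_operator D A)
    (A_unbounded : unbounded D A)
    (A_self_adjoint : self_adjoint ip D A)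
    (A_positive : positive_on ip D A)
    (A_compact_resolvent : compact_resolvent D A)
    (mu_gt0 : 0 < mu 0%N)
    (mu_increasing : increasing_seq mu)
    (A_spectrum : spectrum D A = range (fun k => (mu k)%:C))
    (phi_basis : orthonormal_basis ip phi)
    (phi_eigen : forall k, D (phi k) /\ A (phi k) = (mu k)%:C *: phi k)
    (K_linear : linear_operator D K)
    (K_symmetric : symmetric_on ip D K)
    (K_nonnegative : nonnegative_on ip D K)
    (K_compact : compact_operator D (fun u => `|A u|) K)
    (mut_eigenvalues : eigenvalues_with_multiplicity D (A \+ K) mut) :
  exists f : R -> R,
    [/\ {within `[0, +oo[, continuous f},
        f x @[x --> +oo] --> 0 &
        forall n, mut n = mu n * (1 + f (mu n))].
Proof.
have mu_nd : nondecreasing_seq mu by move=> m n; rewrite mu_increasing.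
have mu_pos k : 0 < mu k by apply: lt_le_trans mu_gt0 (mu_nd _ _ (leq0n k)).
have A_symmetric : symmetric_on ip D A.
  by move=> u v Du Dv; have [_ /(_ v (A v))[_ ->]] := A_self_adjoint.
(* Every mu_k being positive, 0 lies outside the spectrum and the resolvent at 0 inverts [A]. *)
have A_surjective x : exists2 u, D u & A u = x.
  have : ~ spectrum D A 0.
    rewrite A_spectrum => -[k _ [mk]].
    by have := mu_pos k; rewrite mk ltxx.
  move=> /contrapT[S [_ /(_ x)[DS]]]; rewrite scale0r subr0 => AS _.
  by exists (S x).
have mu_unbounded c : exists n, c < mu n.
  apply: contrapT => nc; apply: A_unbounded; exists c.
  apply: (bounded_of_bounded_eigenvalues ip_norm A_symmetric mu_pos phi_basis phi_eigen).
  by move=> k; rewrite leNgt; apply/negP => ?; apply: nc; exists k.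
have le_mut := eigenvalue_le_perturbed ip_norm A_linear A_symmetric mu_nd
  phi_basis phi_eigen K_linear K_symmetric K_nonnegative mut_eigenvalues.
have mut_le := perturbed_eigenvalue_le ip_norm A_linear A_symmetric A_positive
  A_compact_resolvent A_surjective mu_pos mu_nd phi_basis phi_eigen K_linear
  K_symmetric K_nonnegative K_compact mut_eigenvalues.
pose a n := mut n / mu n - 1.
have a0 : a @ \oo --> 0.
  apply/cvgr0Pnorm_lt => e e0; have e2 : 0 < e / 2 by rewrite divr_gt0.
  have [c cP] := mut_le _ e2.
  (* Beyond n0, c < (e / 2) mu_n, whence 0 <= a n <= e / 2 + c / mu_n < e. *)
  have [n0 n0P] := mu_unbounded (c / (e / 2)).
  exists n0 => // n /= n0n.
  rewrite ger0_norm; last by rewrite subr_ge0 ler_pdivlMr // mul1r.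
  rewrite ltrBlDr ltr_pdivrMr //; apply: le_lt_trans (cP n) _.
  have : c < e / 2 * mu n.
    rewrite mulrC -ltr_pdivrMr //; exact: lt_le_trans n0P (mu_nd _ _ n0n).
  lra.
have [f [fc f0 fmu]] := continuous_interpolation mu_increasing mu_unbounded a0.
exists f; split=> //.
  exact: continuous_subspaceT.
by move=> n; rewrite fmu /a addrC subrK mulrC divfK // gt_eqF.
Qed.
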